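(* Let $r\ge 3$ and $n>2r(r-1)$, and let $H$ be a connected $r$-graph on $n$ vertices. If $\delta_1(H)>r$, then $\ell(H)\ge 2r+1$.
   Context: An $r$-graph is a simple $r$-uniform hypergraph; $\delta_1(H)$ is its minimum vertex degree. A Berge path of length $t$ consists of $t+1$ distinct vertices $v_0,\dots,v_t$ and $t$ distinct edges $e_1,\dots,e_t$ with $\{v_{i-1},v_i\}\subseteq e_i$. $H$ is connected if every two vertices are joined by a Berge path; $\ell(H)$ is the length of a longest Berge path in $H$. *)

(* Defs.v *)
From mathcomp Require Import all_boot.

Set Implicit Arguments.
Unset Strict Implicit.
Unset Printing Implicit Defensive.

Section Hypergraph.

Variable V : finType.
Implicit Types (H : {set {set V}}) (v : V).

(* A simple hypergraph on the vertex set V is its set of edges H. *)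
Definition uniform (r : nat) H : Prop := forall e : {set V}, e \in H -> #|e| = r.

Definition degree H v : nat := #|[set e in H | v \in e]|.

(* Every degree is at most #|H|, so the default value #|H| does not affect the
   minimum when V is nonempty. *)
Definition min_degree H : nat := \big[minn/#|H|]_(v : V) degree H v.

(* Position i : 'I_t stands for the step from p i to p i.+1 through the edge
   e i, which is e_{i+1} in 1-based indexing. *)
Definition berge_path H (t : nat) (p : {ffun 'I_t.+1 -> V})
    (e : {ffun 'I_t -> {set V}}) : bool :=
  [&& injectiveb p, injectiveb e &
      [forall i : 'I_t, (e i \in H) &&
         ([set p (widen_ord (leqnSn t) i); p (lift ord0 i)] \subset e i)]].

Definition connected H : Prop :=
  forall u v : V, exists (t : nat) (p : {ffun 'I_t.+1 -> V})
    (e : {ffun 'I_t -> {set V}}),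
    [/\ berge_path H p e, p ord0 = u & p ord_max = v].

Definition has_berge_path H (t : nat) : bool :=
  [exists p : {ffun 'I_t.+1 -> V}, exists e : {ffun 'I_t -> {set V}},
     berge_path H p e].

(* The t.+1 vertices of a Berge path are distinct, so t < #|V| is no
   restriction (see has_berge_path_ltn). *)
Definition longest_berge_path H : nat :=
  \max_(t < #|V| | has_berge_path H t) t.

Lemma degree_le_edges H v : degree H v <= #|H|.
Proof. by apply/subset_leq_card/subsetP => e; rewrite inE => /andP[]. Qed.

Lemma min_degree_gtP H k : 0 < #|V| ->
  reflect (forall v, k < degree H v) (k < min_degree H).
Proof.
move=> V_gt0; apply: (iffP idP) => [k_lt v|k_lt].
  apply: leq_trans k_lt _; rewrite /min_degree.
  have: v \in index_enum V by rewrite mem_index_enum.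
  elim: (index_enum V) => //= x s IHs; rewrite inE big_cons.
  by case/predU1P=> [<-|/IHs]; [apply: geq_minl | apply: leq_trans (geq_minr _ _)].
have /card_gt0P[v0 _] := V_gt0.
rewrite /min_degree; elim/big_ind: _ => //.
  by apply: leq_trans (k_lt v0) (degree_le_edges H v0).
by move=> x y kx ky; rewrite leq_min kx ky.
Qed.

Lemma has_berge_path_ltn H t : has_berge_path H t -> t < #|V|.
Proof.
case/existsP=> p /existsP[e /and3P[/injectiveP injp _ _]].
by rewrite -[t.+1]card_ord; apply: leq_card injp.
Qed.

Lemma leq_longest_berge_path H t :
  has_berge_path H t -> t <= longest_berge_path H.
Proof.
move=> Ht; have t_lt := has_berge_path_ltn Ht.
by rewrite /longest_berge_path (bigmax_sup (Ordinal t_lt)).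
Qed.

Lemma longest_berge_path_attained H :
  0 < #|V| -> has_berge_path H (longest_berge_path H).
Proof.
move=> V_gt0; have /card_gt0P[v0 _] := V_gt0.
have H0 : has_berge_path H 0.
  apply/existsP; exists [ffun=> v0]; apply/existsP; exists [ffun=> set0].
  apply/and3P; split; last by apply/forallP=> -[].
    by apply/injectiveP=> x y _; rewrite (ord1 x) (ord1 y).
  by apply/injectiveP=> -[].
rewrite /longest_berge_path.
have [|t Ht ->] := @eq_bigmax_cond _ [pred t : 'I_#|V| | has_berge_path H t]
  (fun t => t : nat); last by [].
by apply/card_gt0P; exists (Ordinal V_gt0).
Qed.

End Hypergraph.

(* Main.v *)
Require Import Defs.
From mathcomp Require Import all_boot.
From mathcomp Require Import zify.

(** Suppose the longest Berge path has length l <= 2r. A Berge cycle of length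
    l + 1 could be extended by connectivity. So could one of length l: as
    n > 2r(r - 1), some vertex w lies on no edge of the cycle; its r + 1 edges
    then stay in the cycle plus w, and w can be inserted between two consecutive
    cycle vertices. For a longest path p_0 ... p_l with edges e_i joining p_i to
    p_{i+1}, let X (resp. Y) be the set of i such that p_0 reaches p_{i+1}
    (resp. p_l reaches p_i) through an edge other than the e_j, j <> i. If
    i + 1 is in X and i in Y, we get a cycle of length l; hence
    |X| + |Y| <= l + 1, and one end, say p_0, has |X| <= r. Counting its edges
    against X leaves one case, in which p_0 lies on a single edge f outside the
    path. The same holds for the ends obtained by rotating the path at a
    neighbour of p_0 in f, which forces the vertices of f to be an initial
    segment p_0 ... p_m of the path, all of them in e_{m-1}; so f = e_{m-1}. *)

Set Implicit Arguments.
Unset Strict Implicit.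
Unset Printing Implicit Defensive.

(** * Berge paths and cycles indexed by natural numbers *)

Section Walks.

Variables (V : finType) (H : {set {set V}}).
Implicit Types (p q : nat -> V) (e : nat -> {set V}) (h f : {set V}).

Definition bpath l p e : Prop :=
  [/\ forall i j, i <= l -> j <= l -> p i = p j -> i = j,
      forall i j, i < l -> j < l -> e i = e j -> i = j
    & forall i, i < l -> [/\ e i \in H, p i \in e i & p i.+1 \in e i]].

(** Periodic sequences let a cycle be cut open at any index by a mere shift; distinctness is asked
    in each window of [c] consecutive indices. *)
Definition bcycle c p e : Prop :=
  [/\ forall k, p (k + c) = p k /\ e (k + c) = e k,
      forall i j, i < j < i + c -> p i <> p j,
      forall i j, i < j < i + c -> e i <> e j
    & forall i, [/\ e i \in H, p i \in e i & p i.+1 \in e i]].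

Lemma has_berge_pathP l : has_berge_path H l <-> exists p e, bpath l p e.
Proof.
split.
  case/existsP=> p /existsP[e /and3P[/injectiveP injp /injectiveP inje /forallP pe]].
  exists (fun k => p (inord k)).
  (* ['I_l] may be empty, hence [insub] instead of [inord]; the default [set0] occurs only at
     indices from [l] on, which [bpath] ignores. *)
  exists (fun k => if insub k is Some i then e i else set0); split.
  - move=> i j il jl /injp /(congr1 val) /=; by rewrite !inordK.
  - move=> i j il jl; rewrite !insubT => /inje /(congr1 val) //.
  - move=> i il; rewrite insubT; have /andP[-> /subsetP s] := pe (Sub i il).
    split=> //; apply: s; rewrite !inE; apply/orP; [left|right]; apply/eqP; congr (p _);
      apply: val_inj; rewrite /= inordK //; lia.
case=> p [e [injp inje pe]]; apply/existsP; exists [ffun i : 'I_l.+1 => p i].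
apply/existsP; exists [ffun i : 'I_l => e i]; apply/and3P; split.
- apply/injectiveP => i j; rewrite !ffunE => ij; apply: val_inj;
  by apply: injp ij; rewrite -ltnS.
- apply/(@injectiveP _ _ [ffun i : 'I_l => e i]) => i j; rewrite !ffunE => ij;
  by apply: val_inj; apply: inje ij.
- apply/forallP => i; rewrite !ffunE; have [-> pi pi1] := pe i (ltn_ord i).
  by apply/subsetP => x; rewrite !inE => /orP[]/eqP->.
Qed.

(** If no step of a Berge path from [u] to [v] left [S], membership in [S] would propagate along it
    to [v]. *)
Lemma connected_cut (S : {set V}) u v : connected H -> u \in S -> v \notin S ->
  exists h x y, [/\ h \in H, x \in h, y \in h, x \in S & y \notin S].
Proof.
move=> /(_ u v) [t [p [e [/and3P[_ _ /forallP pe] <- <-]]]] p0S ptS.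
have [i pi] : exists i : 'I_t,
    (p (widen_ord (leqnSn t) i) \in S) && (p (lift ord0 i) \notin S).
  apply/existsP; apply: contraNT ptS; rewrite negb_exists => /forallP nS.
  suff pS k : k <= t -> p (inord k) \in S.
    by have := pS t (leqnn t); congr (p _ \in S); apply: val_inj; rewrite /= inordK.
  elim: k => [_|k IHk kt]; first by move: p0S;
    congr (p _ \in S); apply: val_inj; rewrite /= inordK.
  have := nS (Ordinal kt); rewrite negb_and negbK => /orP[/negP[]|].
    move: (IHk (ltnW kt)); congr (p _ \in S); apply: val_inj; rewrite /= inordK //; lia.
  by congr (p _ \in S); apply: val_inj; rewrite /= inordK.
case/andP: pi => piS piS'; have /andP[eH /subsetP s] := pe i.
by exists (e i), (p (widen_ord (leqnSn t) i)), (p (lift ord0 i));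
  split=> //; apply: s; rewrite !inE eqxx ?orbT.
Qed.

Lemma bpath_cons l p e w h : bpath l p e -> (forall i, i <= l -> p i <> w) ->
    h \in H -> w \in h -> p 0 \in h -> (forall j, j < l -> e j <> h) ->
  bpath l.+1 (fun k => if k is k'.+1 then p k' else w)
             (fun k => if k is k'.+1 then e k' else h).
Proof.
move=> [injp inje pe] wp hH wh p0h eh; split.
- move=> [|i] [|j] //=; first by move=> _ jl wE; case: (wp j).
    by move=> il _; move/wp.
  by move=> il jl /injp ->.
- move=> [|i] [|j] //=; first by move=> _ jl wE; case: (eh j).
    by move=> il _; move/eh.
  by move=> il jl /inje ->.
- by case=> [|i] il; [split | apply: pe].
Qed.

Definition revp l p k := p (l - k).
Definition reve l e k : {set V} := e (l - k.+1).

Lemma bpath_rev l p e : bpath l p e -> bpath l (revp l p) (reve l e).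
Proof.
move=> [injp inje pe]; rewrite /revp /reve; split.
- by move=> i j il jl /injp; lia.
- by move=> i j il jl /inje; lia.
- move=> i il; have [|eH a b] := pe (l - i.+1); first by lia.
  by split=> //; move: b; rewrite -subSn // subSS.
Qed.

(* The first m.+1 vertices are traversed backwards, the next d are skipped,
   and f replaces the edges in between. *)
Definition rotp m d p k := if k <= m then p (m - k) else p (k + d).
Definition rote m d f e k : {set V} :=
  if k < m then e (m - k.+1) else if k == m then f else e (k + d).

Lemma bpath_rot l m d p e f : bpath l p e -> m + d < l ->
    f \in H -> p 0 \in f -> p (m + d).+1 \in f ->
    (forall j, j < l -> (j < m) || (m + d < j) -> e j <> f) ->
  bpath (l - d) (rotp m d p) (rote m d f e).
Proof.
move=> [injp inje pe] ml fH p0f pmf ef; rewrite /rotp /rote; split.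
- by move=> i j il jl; case: ifP; case: ifP => c1 c2 /injp; lia.
- move=> i j il jl; case: ltnP => c1; case: ltnP => c2; try by move=> /inje; lia.
  + by case: eqP => c3; [move/ef|move/inje]; lia.
  + by case: eqP => c3; [move/esym/ef|move/inje]; lia.
  + case: eqP => c3; case: eqP => c4; first by lia.
    * by move/esym/ef; lia.
    * by move/ef; lia.
    * by move/inje; lia.
- move=> i il; case: (ltngtP i m) => c1.
  + have [|eH a b] := pe (m - i.+1); first by lia.
    split=> //.
    by move: b; rewrite -subSn // subSS.
  + have [|eH a b] := pe (i + d); first by lia.
    by rewrite -addSn in b.
  + by rewrite c1 subnn -addSn in pmf *.
Qed.

Lemma bcycle_mod c p e k : bcycle c p e -> p k = p (k %% c) /\ e k = e (k %% c).
Proof.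
case=> per _ _ _; rewrite {1 3}(divn_eq k c) addnC.
elim: (k %/ c) => [|q [IHp IHe]]; first by rewrite mul0n addn0.
by rewrite mulSn [c + _]addnC addnA !(per _).1 !(per _).2.
Qed.

Lemma bcycle_path c p e t : bcycle c.+1 p e ->
  bpath c (fun k => p (t + k)) (fun k => e (t + k)).
Proof.
case=> per winp wine pe; split.
- move=> i j il jl E; case: (ltngtP i j) => // ij.
    by case: (winp (t + i) (t + j)) => //; lia.
  by case: (winp (t + j) (t + i)) => //; lia.
- move=> i j il jl E; case: (ltngtP i j) => // ij.
    by case: (wine (t + i) (t + j)) => //; lia.
  by case: (wine (t + j) (t + i)) => //; lia.
- by move=> i _; rewrite addnS.
Qed.

Lemma bcycle_close m p e h : bpath m p e -> h \in H -> p 0 \in h -> p m \in h ->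
    (forall j, j < m -> e j <> h) ->
  bcycle m.+1 (fun k => p (k %% m.+1))
    (fun k => if k %% m.+1 == m then h else e (k %% m.+1)).
Proof.
move=> [injp inje pe] hH p0h pmh eh.
have lem k : k %% m.+1 <= m by rewrite -ltnS ltn_mod.
have win i j : i < j < i + m.+1 -> i %% m.+1 <> j %% m.+1.
  move=> ij /eqP; rewrite eq_sym eqn_mod_dvd; last by lia.
  by move/dvdn_leq; lia.
split.
- by move=> k; rewrite modnDr.
- by move=> i j /win ij /injp ij'; apply: ij; apply: ij'.
- move=> i j /win ij; have := lem i; have := lem j.
  case: eqP => ci; case: eqP => cj lj li; first by lia.
  + by move/esym/eh; lia.
  + by move/eh; lia.
  + by move/inje; lia.
- move=> i; have li := lem i; rewrite -[i.+1]addn1 -modnDml addn1.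
  case: eqP => ci; first by rewrite ci modnn.
  have ltm : i %% m.+1 < m by lia.
  by rewrite [(i %% m.+1).+1 %% _]modn_small //; apply: pe.
Qed.

(* If h is a cycle edge the tour starts with h itself, otherwise with any
   vertex of the cycle in h. *)
Lemma bcycle_attach c p e w h t : bcycle c.+1 p e -> (forall k, p k <> w) ->
    h \in H -> w \in h -> p t \in h ->
  exists q g, [/\ bpath c.+1 q g, q 0 = w, forall i, 0 < i -> exists k, q i = p k
    & forall i, g i = h \/ exists k, g i = e k].
Proof.
move=> C wp hH wh pth.
suff [u pu eu] : exists2 u, p u \in h & forall j, j < c -> e (u + j) <> h.
  exists (fun k => if k is k'.+1 then p (u + k') else w).
  exists (fun k => if k is k'.+1 then e (u + k') else h); split=> //.
  - apply: bpath_cons => //; [exact: bcycle_path | by rewrite addn0].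
  - by case=> // i _; exists (u + i).
  - by case=> [|i]; [left | right; exists (u + i)].
have [/existsP[k /eqP ek]|/existsPn nk] := boolP [exists k : 'I_c.+1, e k == h].
  have [per winp wine pe] := C.
  exists k.+1; first by rewrite -ek; case: (pe k).
  by move=> j jc; rewrite -ek => /esym; apply: wine; lia.
exists t => // j _ E; have := nk (Ordinal (ltn_pmod (t + j) (ltn0Sn c))).
by rewrite /= -(bcycle_mod _ C).2 E eqxx.
Qed.

End Walks.

(** * Counting families of k-subsets *)

Lemma card_ksubsets (T : finType) (L : {set {set T}}) (B : {set T}) k :
  (forall h, h \in L -> h \subset B /\ #|h| = k) -> #|L| <= 'C(#|B|, k).
Proof.
move=> LB; rewrite -cards_draws; apply/subset_leq_card/subsetP => h /LB[hB hk].
by rewrite inE hB hk eqxx.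
Qed.

(* Let R be the set of elements of N := cover L whose successor is not in N, so that
   2 #|R| <= #|T|. A set of L not inside R contains y and s y with s y \in R, and it
   is the only set of L containing s y. *)
Lemma card_cyclic_links (T : finType) (s : T -> T) (L : {set {set T}}) k :
    injective s ->
    (forall S : {set T}, S != set0 -> (forall x, x \in S -> s x \in S) -> S = setT) ->
    0 < k -> #|T| <= 2 * k.+1 -> (forall h, h \in L -> #|h| = k) ->
    (forall x h1 h2, h1 \in L -> h2 \in L -> x \in h1 -> s x \in h2 -> h1 = h2) ->
  #|L| <= k.+1.
Proof.
move=> injs trs k_gt0 leT Lk sL; set N := cover L.
have inN h x : h \in L -> x \in h -> x \in N by move=> hL xh; apply/bigcupP; exists h.
pose R := [set x in N | s x \notin N].
have RN : R \subset N by apply/subsetP => x; rewrite inE => /andP[].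
have leRN : #|R| + #|N| <= 2 * k.+1.
  apply: leq_trans leT; rewrite -(card_imset R injs) -cardsUI.
  rewrite [_ :&: N](_ : _ = set0) ?cards0 ?addn0 ?max_card //.
  apply/setP => x; rewrite !inE; apply/negP => /andP[/imsetP[y]].
  by rewrite inE => /andP[_ /negP n ->].
have sh h x : h \in L -> x \in h -> x \notin R -> s x \in h.
  move=> hL xh; rewrite inE (inN h) //= negbK => /bigcupP[h2 h2L sxh2].
  by rewrite (sL x h h2).
(* Exceptional case: [h :\: R] is closed under [s], hence is all of [T]. Any member of [L] then
   contains some [x] with [s x] in [h], so it equals [h]. *)
have [/existsP[h /andP[/andP[hL hR] /forallP nh]]|/existsPn ex] :=
  boolP [exists h, (h \in L) && ~~ (h \subset R) &&
           [forall y, (y \in h :\: R) ==> (s y \notin R)]].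
  have hRT : h :\: R = setT.
    apply: trs => [|x xh]; first by rewrite setD_eq0.
    have /implyP/(_ xh) := nh x; case/setDP: xh => xh xR.
    by rewrite in_setD => ->; apply: sh.
  suff: #|L| <= #|[set h]| by rewrite cards1; lia.
  apply/subset_leq_card/subsetP => h2 h2L; rewrite inE; apply/eqP.
  have /card_gt0P[x xh2] : 0 < #|h2| by rewrite Lk.
  apply: (sL x) => //.
  by have := in_setT (s x); rewrite -hRT => /setDP[].
pose L1 := [set h in L | h \subset R].
have leL1 : #|L1| <= 'C(#|R|, k).
  by apply: card_ksubsets => h; rewrite inE => /andP[/Lk -> ->].
have leL2 : #|L :\: L1| <= #|R|.
  (* [F] recovers a set of [L] not inside [R] from the point [s y] of [R] that it contains, so [R]
     has at least as many points as there are such sets. *)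
  pose F z := odflt set0 [pick h in L | z \in h].
  apply: leq_trans (leq_imset_card F (mem R)).
  apply/subset_leq_card/subsetP => h; rewrite !inE => /andP[]; rewrite negb_and => + hL.
  rewrite hL /= => hR; have := ex h; rewrite hL hR /= => /forallPn[y].
  rewrite negb_imply negbK => /andP[/setDP[yh yR] syR].
  apply/imsetP; exists (s y) => //; rewrite /F; case: pickP => [h2 /andP[h2L syh2]|/(_ h)] /=.
    exact: (sL y).
  by rewrite hL sh.
have LE : #|L| = #|L1| + #|L :\: L1|.
  by rewrite -(cardsID L1 L) (setIidPr _) //; apply/subsetP => h; rewrite inE => /andP[].
have leN := subset_leq_card RN.
(* For |R| < k no k-set fits in [R]. For |R| > k, [leRN] and |R| <= |N| force |R| = |N| = k + 1, so
   all of [L] lies in [R]. For |R| = k the count is at most 1 + k. *)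
have [Rk|Rk|Rk] := ltngtP #|R| k.
- by move: leL1; rewrite bin_small //; lia.
- have NR : N = R by apply/esym/eqP; rewrite eqEcard RN; lia.
  have L1E : L1 = L.
    apply/setP => h; rewrite inE; case hL: (h \in L) => //=.
    by rewrite -NR; apply/subsetP => x; apply: inN.
  move: leL1; rewrite L1E; have -> : #|R| = k.+1 by lia.
  by rewrite binSn.
- by move: leL1; rewrite Rk binn; lia.
Qed.

(** * Excluding Berge cycles of lengths l + 1 and l *)

Section LongCycles.

Variables (V : finType) (H : {set {set V}}) (r l : nat).
Hypotheses (r_ge3 : 3 <= r) (l_le : l <= 2 * r) (V_gt : 2 * r * (r - 1) < #|V|).
Hypotheses (Hr : uniform r H) (Hconn : connected H).
Hypothesis Hdeg : forall v, r < degree H v.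
Hypothesis Hmax : forall p e, ~ bpath H l.+1 p e.

Implicit Types (p q : nat -> V) (e : nat -> {set V}) (h f : {set V}).

Lemma bcycle_support c p e v : bcycle H c.+1 p e -> v \notin [set p i | i : 'I_c.+1] ->
  forall k, p k <> v.
Proof.
move=> C /imsetP vC k pk; apply: vC; exists (Ordinal (ltn_pmod k (ltn0Sn c))) => //=.
by rewrite -(bcycle_mod _ C).1.
Qed.

(** The cycle has at most 2r + 1 < n vertices, so by connectivity some edge leads from it to a
    vertex outside; a tour from that vertex has length l + 1. *)
Lemma no_bcycle_succ p e : ~ bcycle H l.+1 p e.
Proof.
move=> C; pose S := [set p i | i : 'I_l.+1].
have [v vS] : exists v, v \notin S.
  apply/existsP; rewrite -negb_forall; apply/negP => /forallP SV.
  have : #|V| <= #|S| by rewrite -cardsT; apply/subset_leq_card/subsetP => x _.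
  have := leq_imset_card (fun i : 'I_l.+1 => p i) (mem 'I_l.+1); rewrite card_ord -/S.
  by nia.
have p0S : p 0 \in S by apply/imsetP; exists ord0.
have [h [x [y [hH xh yh /imsetP[t _ xE] yS]]]] := connected_cut Hconn p0S vS.
rewrite {}xE in xh.
have [q [g [/Hmax []]]] := bcycle_attach C (bcycle_support C yS) hH yh xh.
Qed.

Lemma no_chord p e h : bpath H l p e -> h \in H -> p 0 \in h -> p l \in h ->
  (forall j, j < l -> e j <> h) -> False.
Proof. by move=> P hH p0 pl /(bcycle_close P hH p0 pl) /no_bcycle_succ. Qed.

Lemma no_bcycle p e : 1 < l -> ~ bcycle H l p e.
Proof.
case: l l_le Hmax no_chord => // c c_le Hm nochord c_gt0 C.
have [per winp wine pe] := C.
pose S := [set p i | i : 'I_c.+1].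
have inS k : p k \in S.
  by apply/imsetP; exists (Ordinal (ltn_pmod k (ltn0Sn c))); rewrite //= -(bcycle_mod _ C).1.
have [w wE] : exists w, forall k, w \notin e k.
  (* Removing [p k] from [e k] leaves r - 1 vertices, so |U| <= 2r(r - 1) < n. Yet [U] contains
     every vertex of every [e k], because [p k] also lies on the preceding edge, of index [k + c]
     modulo [c.+1]. *)
  pose U := \bigcup_(k < c.+1) (e k :\ p k).
  have [w wU] : exists w, w \notin U.
    apply/existsP; rewrite -negb_forall; apply/negP => /forallP UV.
    have : #|V| <= #|U| by rewrite -cardsT; apply/subset_leq_card/subsetP => x _.
    have : #|U| <= \sum_(k < c.+1) (r - 1).
      apply: leq_trans (_ : \sum_(k < c.+1) #|e k :\ p k| <= _).
        rewrite /U; elim/big_rec2: _ => [|k m A _ leA]; first by rewrite cards0.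
        by apply: leq_trans (leq_card_setU _ _) _; rewrite leq_add2l.
      apply: leq_sum => k _; have [ekH pk _] := pe k.
      by have := cardsD1 (p k) (e k); rewrite pk Hr //; lia.
    by rewrite sum_nat_const card_ord; nia.
  exists w => k; apply/negP => wk.
  have wU' j : w \in e j -> p j = w.
    move=> wj; apply/eqP; apply: contraNT wU => pjw; apply/bigcupP.
    exists (Ordinal (ltn_pmod j (ltn0Sn c))) => //=.
    by rewrite !inE -(bcycle_mod _ C).1 -(bcycle_mod _ C).2 wj eq_sym pjw.
  have pkw := wU' k wk.
  have [_ _ wc] := pe (k + c); rewrite -addnS (per k).1 pkw in wc.
  by case: (winp k (k + c)); [lia | rewrite pkw (wU' _ wc)].
have wp k : p k <> w by move=> pkw; have := wE k; case: (pe k) => _; rewrite pkw => ->.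
have wS : w \notin S by apply/imsetP => -[k _ /esym]; apply: wp.
(* [Q] consists of the cycle and its neighbours. An edge from [x] in [Q] to [y] outside [Q] avoids
   the cycle, so [y] can be prepended to a tour starting at [x], which gives length l + 1. *)
have touch v : v \notin S -> exists h t, [/\ h \in H, v \in h & p t \in h].
  pose Q := S :|: [set v | [exists h, exists t : 'I_c.+1, [&& h \in H, v \in h & p t \in h]]].
  have [vQ|vQ] := boolP (v \in Q).
    move=> vS; move: vQ; rewrite !inE (negPf vS) => /existsP[h /existsP[t /and3P[? ? ?]]].
    by exists h, t.
  have p0Q : p 0 \in Q by rewrite inE inS.
  have [h [x [y [hH xh yh xQ yQ]]]] := connected_cut Hconn p0Q vQ.
  move: yQ; rewrite !inE negb_or => /andP[yS /existsPn yn].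
  have hS t : p t \notin h.
    apply/negP => pth; have := yn h => /existsPn/(_ (Ordinal (ltn_pmod t (ltn0Sn c)))).
    by rewrite hH yh /= -(bcycle_mod _ C).1 pth.
  have xS : x \notin S by apply/imsetP => -[t _ xE]; have := hS t; rewrite -xE xh.
  move: xQ; rewrite !inE (negPf xS) => /existsP[h2 /existsP[t /and3P[h2H xh2 pth2]]].
  have [q [g [P q0 qp ge]]] := bcycle_attach C (bcycle_support C xS) h2H xh2 pth2.
  case: (Hm _ _ (bpath_cons (w := y) (h := h) P _ hH yh _ _)).
  - case=> [|i] _; last by have [//|k ->] := qp i.+1; apply: bcycle_support C yS k.
    by rewrite q0 => xy; have := yn h2 => /existsPn/(_ t); rewrite h2H pth2 -xy xh2.
  - by rewrite q0.
  - move=> j _ gh; have [gj|[k gj]] := ge j.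
      by have := hS t; rewrite -gh gj pth2.
    by have := hS k; rewrite -gh gj; case: (pe k) => _ ->.
(* A vertex of [h2] outside the cycle and distinct from [w] could be prepended to the tour that
   starts at [w] through [h]; [h2] is not a cycle edge because [w] is on none. *)
have away h h2 t : h \in H -> w \in h -> p t \in h -> h2 \in H -> w \in h2 -> h2 != h ->
    h2 \subset w |: S.
  move=> hH wh pth h2H wh2 h2h; apply/subsetP => z zh2; rewrite !inE.
  apply/negP => /negP; rewrite negb_or => /andP[zw zS].
  have [q [g [P q0 qp ge]]] := bcycle_attach C wp hH wh pth.
  case: (Hm _ _ (bpath_cons (w := z) (h := h2) P _ h2H zh2 _ _)).
  - case=> [|i] _; last by have [//|k ->] := qp i.+1; apply: bcycle_support C zS k.
    by rewrite q0 => /esym/eqP; apply/negP.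
  - by rewrite q0.
  - move=> j _ gh; have [gj|[k gj]] := ge j; first by rewrite -gj gh eqxx in h2h.
    by have := wE k; rewrite -gj gh wh2.
pose W := [set h in H | w \in h].
have cardW : r < #|W| := Hdeg w.
have meet h : h \in W -> h \subset w |: S -> exists t : 'I_c.+1, p t \in h.
  rewrite inE => /andP[hH wh] /subsetP hS.
  have /card_gt0P[x] : 0 < #|h :\ w| by have := cardsD1 w h; rewrite wh Hr //; lia.
  rewrite !inE => /andP[xw xh]; have := hS x xh; rewrite !inE (negPf xw) => /imsetP[t _ xE].
  by exists t; rewrite -xE.
(* An edge [h0] touching the cycle confines all the others; one of these, [h1], then touches the
   cycle too and confines [h0]. *)
have sub h : h \in W -> h \subset w |: S.
  have [h0 [t0 [h0H wh0 ph0]]] := touch w wS.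
  have sub2 h2 : h2 \in W -> h2 != h0 -> h2 \subset w |: S.
    by rewrite inE => /andP[h2H wh2]; apply: away ph0 _ _.
  have h0W : h0 \in W by rewrite inE h0H wh0.
  have /card_gt0P[h1] : 0 < #|W :\ h0|
    by move: cardW; rewrite (cardsD1 h0) h0W add1n ltnS; apply: leq_trans; lia.
  rewrite in_setD1 => /andP[h10 h1W]; have [t1 ph1] := meet _ h1W (sub2 _ h1W h10).
  case: (eqVneq h h0) => [-> _|h_h0 hW]; last exact: sub2.
  by move: h1W; rewrite inE => /andP[h1H wh1]; apply: (away h1 h0 t1); rewrite // eq_sym.
(* The link of [w], read on cycle indices: distinct edges at [w] give distinct sets of size r - 1.
   As c + 1 <= 2r, [card_cyclic_links] with k = r - 1 allows only r of them. *)
pose lk h := [set i : 'I_c.+1 | p i \in h].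
have pinj : injective (fun i : 'I_c.+1 => p i).
  move=> i j pij; apply: val_inj; have := bcycle_path 0 C => -[/(_ i j) + _ _].
  by rewrite !add0n; apply => //; rewrite -ltnS.
have lkE h : h \in W -> [set p (val i) | i : 'I_c.+1 in lk h] = h :\ w.
  move=> hW; apply/setP => x; apply/imsetP/idP.
    by case=> i; rewrite !inE => pih ->; rewrite pih andbT; apply/eqP/wp.
  rewrite !inE => /andP[xw xh]; have /subsetP/(_ x xh) := sub h hW.
  by rewrite !inE (negPf xw) => /imsetP[i _ xE]; exists i; rewrite ?inE -?xE.
have lkinj : {in W &, injective lk}.
  move=> h1 h2 W1 W2 E; have: h1 :\ w = h2 :\ w by rewrite -!lkE // E.
  move: W1 W2; rewrite !inE => /andP[_ w1] /andP[_ w2] E'.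
  by rewrite -(setD1K w1) E' setD1K.
suff: #|lk @: W| <= (r - 1).+1.
  by rewrite card_in_imset // => leW; have := leq_trans cardW leW; lia.
apply: (@card_cyclic_links _ (@ordS c.+1)).
- exact: ordS_inj.
- move=> A /set0Pn[x xA] sA; apply/setP => y; rewrite inE.
  have it k : iter k (@ordS c.+1) x \in A by elim: k => //= k; apply: sA.
  (* The summand [c.+1] keeps the subtraction from truncating. *)
  suff -> : y = iter (y + c.+1 - x) (@ordS c.+1) x by exact: it.
  have itv k : iter k (@ordS c.+1) x = (x + k) %% c.+1 :> nat.
    elim: k => [|k IHk]; first by rewrite addn0 modn_small.
    by rewrite iterS /= IHk -addn1 modnDml addn1 addnS.
  apply: val_inj; rewrite /= itv; have := ltn_ord x => xc.
  have -> : x + (y + c.+1 - x) = y + c.+1 by lia.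
  by rewrite modnDr modn_small.
- by lia.
- by rewrite card_ord; lia.
- move=> _ /imsetP[h hW ->]; have := lkE h hW => /(congr1 (fun A : {set V} => #|A|)).
  rewrite card_imset // => ->; move: hW; rewrite inE => /andP[hH wh].
  by have := cardsD1 w h; rewrite wh Hr //; lia.
- move=> x _ _ /imsetP[h1 W1 ->] /imsetP[h2 W2 ->].
  rewrite !inE /= -(bcycle_mod _ C).1 => xh1 sxh2.
  congr lk; apply/eqP; apply/negP => /negP h12.
  move: W1 W2; rewrite !inE => /andP[h1H wh1] /andP[h2H wh2].
  (* [Q] runs backwards around the cycle from [p x] to [p x.+1]. Prepending [w] through [h1] and
     closing with [h2] inserts [w] between these two vertices, a cycle of length l + 1. *)
  have Q := bpath_rev (bcycle_path x.+1 C).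
  have := bpath_cons Q (w := w) (h := h1) _ h1H wh1.
  rewrite /revp subn0 addSnnS (per x).1 => /(_ _ xh1) Q'.
  apply: (nochord _ _ h2 (Q' _ _)) => //=.
  + move=> j _; rewrite /reve => E.
    by have := wE (x.+1 + (c - j.+1)); rewrite E wh1.
  + by rewrite subnn addn0.
  + case=> [_|j _]; first by move/eqP; apply/negP.
    by rewrite /reve => E; have := wE (x.+1 + (c - j.+1)); rewrite E wh2.
Qed.

Lemma no_small_chord p e h :
  1 < l -> bpath H l.-1 p e -> h \in H -> p 0 \in h -> p l.-1 \in h ->
  (forall j, j < l.-1 -> e j <> h) -> False.
Proof.
move=> l1 P hH p0 pl /(bcycle_close P hH p0 pl).
by rewrite prednK; [apply: no_bcycle | lia].
Qed.

End LongCycles.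

(** * Links at the two ends of a path of length l *)

Section PathEnds.

Variables (V : finType) (H : {set {set V}}) (r l : nat).
Hypotheses (r_ge3 : 3 <= r) (l_le : l <= 2 * r).
Hypotheses (Hr : uniform r H).
Hypothesis Hdeg : forall v, r < degree H v.
Hypothesis Hmax : forall p e, ~ bpath H l.+1 p e.

Implicit Types (p q : nat -> V) (e : nat -> {set V}) (h f : {set V}).

Hypothesis no_chord : forall p e h,
  bpath H l p e -> h \in H -> p 0 \in h -> p l \in h ->
  (forall j, j < l -> e j <> h) -> False.
Hypothesis no_small_chord : forall p e h,
  1 < l -> bpath H l.-1 p e -> h \in H -> p 0 \in h -> p l.-1 \in h ->
  (forall j, j < l.-1 -> e j <> h) -> False.

(* [slinks] and [elinks] below are the sets X and Y of the header. *)
Definition slink p e i h :=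
  [/\ h \in H, p 0 \in h, p i.+1 \in h & forall j, j < l -> j <> i -> e j <> h].
Definition elink p e i h :=
  [/\ h \in H, p l \in h, p i \in h & forall j, j < l -> j <> i -> e j <> h].

Definition slinks p e : {set 'I_l} :=
  [set i : 'I_l | [exists h, [&& h \in H, p 0 \in h, p i.+1 \in h
                           & [forall j : 'I_l, (j != i) ==> (e j != h)]]]].
Definition elinks p e : {set 'I_l} :=
  [set i : 'I_l | [exists h, [&& h \in H, p l \in h, p i \in h
                           & [forall j : 'I_l, (j != i) ==> (e j != h)]]]].

Lemma avoidP e (i : 'I_l) h :
  reflect (forall j, j < l -> j <> i -> e j <> h)
          [forall j : 'I_l, (j != i) ==> (e j != h)].
Proof.
apply: (iffP forallP) => [ne j jl ji|ne j].
  have /implyP/(_ _)/eqP := ne (Ordinal jl); apply.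
  by apply/eqP => /(congr1 val).
by apply/implyP => ji; apply/eqP/ne => // /val_inj/eqP; apply/negP.
Qed.

Lemma slinksP p e (i : 'I_l) : reflect (exists h, slink p e i h) (i \in slinks p e).
Proof.
rewrite inE; apply: (iffP existsP) => -[h].
  by case/and4P=> hH p0 pi /avoidP ne; exists h.
by case=> hH p0 pi ne; exists h; apply/and4P; split=> //; apply/avoidP.
Qed.

Lemma elinksP p e (i : 'I_l) : reflect (exists h, elink p e i h) (i \in elinks p e).
Proof.
rewrite inE; apply: (iffP existsP) => -[h].
  by case/and4P=> hH p0 pi /avoidP ne; exists h.
by case=> hH p0 pi ne; exists h; apply/and4P; split=> //; apply/avoidP.
Qed.

Lemma slink_rev p e i h : i < l ->
  slink (revp l p) (reve l e) i h <-> elink p e (l - i.+1) h.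
Proof.
move=> il; rewrite /slink /elink /revp /reve subn0; split=> -[hH pl pi ne]; split=> // j jl ji.
  by have := ne (l - j.+1); rewrite (_ : l - (l - j.+1).+1 = j); [apply|]; lia.
by apply: ne; lia.
Qed.

Lemma elink_rev p e i h : i < l ->
  elink (revp l p) (reve l e) i h <-> slink p e (l - i.+1) h.
Proof.
move=> il; rewrite /slink /elink /revp /reve subnn -subSn // subSS; split=> -[hH pl pi ne];
  split=> // j jl ji; last by apply: ne; lia.
by have := ne (l - j.+1); rewrite (_ : l - (l - j.+1).+1 = j); [apply|]; lia.
Qed.

Lemma card_slinks_rev p e : #|slinks (revp l p) (reve l e)| = #|elinks p e|.
Proof.
rewrite -(card_imset _ (@rev_ord_inj l)); congr #|pred_of_set _|; apply/setP => i.
apply/imsetP/elinksP => [[j /slinksP[h /slink_rev] + ->]|[h hi]].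
  by move=> /(_ (ltn_ord j)) ?; exists h.
exists (rev_ord i); last by rewrite rev_ordK.
apply/slinksP; exists h; apply/slink_rev; first by apply: ltn_ord.
by have /= -> := congr1 val (rev_ordK i).
Qed.

Lemma card_elinks_rev p e : #|elinks (revp l p) (reve l e)| = #|slinks p e|.
Proof.
rewrite -(card_imset _ (@rev_ord_inj l)); congr #|pred_of_set _|; apply/setP => i.
apply/imsetP/slinksP => [[j /elinksP[h /elink_rev] + ->]|[h hi]].
  by move=> /(_ (ltn_ord j)) ?; exists h.
exists (rev_ord i); last by rewrite rev_ordK.
apply/elinksP; exists h; apply/elink_rev; first by apply: ltn_ord.
by have /= -> := congr1 val (rev_ordK i).
Qed.

Lemma bpath_rot_slink p e i f : bpath H l p e -> i < l -> slink p e i f ->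
  bpath H l (rotp i 0 p) (rote i 0 f e).
Proof.
move=> P il [fH p0f pif ef].
have := @bpath_rot _ _ l i 0 p e f P; rewrite subn0 addn0; apply=> // j jl ji.
by apply: ef => //; lia.
Qed.

Lemma rote_avoid e i f h : i < l -> f <> h -> (forall j, j < l -> j <> i -> e j <> h) ->
  forall j, j < l -> rote i 0 f e j <> h.
Proof.
move=> il fh eh j jl; rewrite /rote addn0; case: ltnP => ji; first by apply: eh; lia.
by case: eqP => // ji'; apply: eh.
Qed.

(** When [e i] replaces itself, the rotation merely permutes the path edges. *)
Lemma rote_avoid_inv e i h : i < l ->
  (forall j, j < l -> rote i 0 (e i) e j <> h) -> forall j, j < l -> e j <> h.
Proof.
move=> il eh j jl; case: (ltngtP j i) => ji.
- have /eh : i - j.+1 < l by lia.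
  rewrite /rote.
  have -> : i - (i - j.+1).+1 = j by lia.
  by have -> : i - j.+1 < i by lia.
- by have := eh j jl; rewrite /rote addn0; case: ltngtP ji.
- by have := eh j jl; rewrite /rote ji ltnn eqxx.
Qed.

(** The rotation leaves the path beyond index [i] unchanged, and its only possible new edge is
    [f]. *)
Lemma elink_rot p e i f y g : i < l -> i < y -> f <> g -> elink p e y g ->
  elink (rotp i 0 p) (rote i 0 f e) y g.
Proof.
move=> il iy fg [gH plg pyg eg]; split=> //; rewrite /rotp ?addn0.
- by rewrite leqNgt il.
- by rewrite leqNgt iy.
- move=> j jl jy; rewrite /rote addn0; case: ltnP => ji; first by apply: eg; lia.
  by case: eqP => // ji'; apply: eg.
Qed.

Lemma rotp0 i d p : rotp i d p 0 = p i.
Proof. by rewrite /rotp subn0. Qed.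

(** Rotating through [h1] gives a path from [p i] to [p l]; if [h2] were different, it would be a
    chord of that path. *)
Lemma slink_elink p e i h1 h2 : bpath H l p e -> i < l ->
  slink p e i h1 -> elink p e i h2 ->  h1 = h2.
Proof.
move=> P il S1 [h2H plh2 pih2 eh2]; apply/eqP/negP => /negP/eqP h12.
apply: (no_chord (bpath_rot_slink P il S1) h2H).
- by rewrite rotp0.
- by rewrite /rotp leqNgt il addn0.
- exact: rote_avoid.
Qed.

Lemma slink_elink_pred p e i h1 h2 : bpath H l p e -> i.+1 < l ->
  slink p e i.+1 h1 -> elink p e i h2 -> False.
Proof.
move=> P il [h1H p0h1 pih1 eh1] [h2H plh2 pih2 eh2].
(* If the two edges agree, the two avoidance conditions together exclude every path edge, so [h1] is
   a chord. Otherwise [h2] closes the rotated path that skips [p i.+1] into a cycle of length l. *)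
have [h12|/eqP h12] := eqVneq h1 h2.
  subst h2; apply: (no_chord P h1H) => // j jl E.
  have [ji|ji] := eqVneq j i; first by apply: (eh1 j) => //; lia.
  by apply: (eh2 j) => //; apply/eqP.
have P' : bpath H l.-1 (rotp i 1 p) (rote i 1 h1 e).
  rewrite -subn1; apply: bpath_rot => //; rewrite ?addn1 // => j jl ji.
  by apply: eh1 => //; lia.
apply: (no_small_chord _ P' h2H); first by lia.
- by rewrite rotp0.
- by rewrite /rotp leqNgt ltn_predRL il addn1 prednK //; lia.
- move=> j jl; rewrite /rote; case: ltnP => ji; first by apply: eh2; lia.
  by case: eqP => // ji'; apply: eh2; lia.
Qed.

(** Shifting the end links up by one inside ['I_l.+1] turns the forbidden pair of [slink_elink_pred]
    into a common element. *)
Lemma slinks_elinks_disjoint p e : bpath H l p e ->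
  [disjoint [set widen_ord (leqnSn l) i | i in slinks p e]
          & [set lift ord0 i | i in elinks p e]].
Proof.
move=> P; rewrite -setI_eq0; apply/eqP/setP => k; rewrite !inE; apply/negP.
case/andP=> /imsetP[x /slinksP[h1 S1] ->] /imsetP[y /elinksP[h2 E2]].
move=> /(congr1 val) /= xy; rewrite /bump /= add1n in xy; rewrite xy in S1.
by apply: slink_elink_pred P _ S1 E2; rewrite -xy.
Qed.

Lemma card_slinks_elinks p e : bpath H l p e ->
  #|[set widen_ord (leqnSn l) i | i in slinks p e] :|: [set lift ord0 i | i in elinks p e]|
    = #|slinks p e| + #|elinks p e|.
Proof.
move=> P; rewrite -[LHS]addn0 -(cards0 'I_l.+1).
have /eqP <- : (_ :&: _ == set0) := etrans (setI_eq0 _ _) (slinks_elinks_disjoint P).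
rewrite cardsUI !card_imset //; first exact: lift_inj.
by move=> x y /(congr1 val) /= /val_inj.
Qed.

Lemma leq_slinks_elinks p e : bpath H l p e -> #|slinks p e| + #|elinks p e| <= l.+1.
Proof.
move=> P; rewrite -card_slinks_elinks //.
by apply: leq_trans (max_card _) _; rewrite card_ord.
Qed.

(** * Edges at the start that are not on the path *)

Definition free_edges p e := [set h in H | (p 0 \in h) && [forall j : 'I_l, e j != h]].
Definition own_edges p e : {set 'I_l} := [set i : 'I_l | p 0 \in e i].
Definition free_nbrs p e : {set 'I_l} :=
  [set i : 'I_l | [exists h in free_edges p e, p i.+1 \in h]].

Lemma free_edgesP p e h :
  reflect [/\ h \in H, p 0 \in h & forall j, j < l -> e j <> h] (h \in free_edges p e).
Proof.
rewrite inE; apply: (iffP and3P) => -[hH p0h ne]; split=> //.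
  by move=> j jl; have /forallP/(_ (Ordinal jl))/eqP := ne.
by apply/forallP => j; apply/eqP/ne.
Qed.

Lemma own_slink p e i : bpath H l p e -> i < l -> p 0 \in e i -> slink p e i (e i).
Proof.
move=> [injp inje pe] il p0; have [eH _ pi] := pe i il.
by split=> // j jl ji /inje ij; apply: ji; apply: ij.
Qed.

Lemma free_slink p e i h : h \in free_edges p e -> p i.+1 \in h -> slink p e i h.
Proof. by case/free_edgesP=> hH p0 ne pi; split=> // j jl _; apply: ne. Qed.

Lemma own_sub_slinks p e : bpath H l p e -> own_edges p e \subset slinks p e.
Proof.
move=> P; apply/subsetP => i; rewrite inE => p0.
by apply/slinksP; exists (e i); apply: own_slink.
Qed.

Lemma free_sub_slinks p e : free_nbrs p e \subset slinks p e.
Proof.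
apply/subsetP => i; rewrite inE => /existsP[h /andP[hF pi]].
by apply/slinksP; exists h; apply: free_slink.
Qed.

Lemma free_not_elink p e i h g : bpath H l p e ->
  h \in free_edges p e -> elink p e i g -> h <> g.
Proof.
move=> P /free_edgesP[hH p0 ne] [gH plg _ _] hg; subst g.
exact: (no_chord P hH).
Qed.

(** By [slink_elink] the free edge would also contain [p l], hence be a chord. *)
Lemma free_nbrs_not_elinks p e i : bpath H l p e ->
  i \in free_nbrs p e -> i \notin elinks p e.
Proof.
move=> P; rewrite inE => /existsP[h /andP[hF pi]]; apply/elinksP => -[g G].
apply: (free_not_elink P hF G); apply: slink_elink P _ _ G => //.
exact: free_slink.
Qed.

Definition free_ball p e := p 0 |: [set p (val i).+1 | i : 'I_l in free_nbrs p e].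

Lemma card_ball p e (A : {set 'I_l}) : bpath H l p e ->
  #|p 0 |: [set p (val i).+1 | i : 'I_l in A]| = #|A|.+1.
Proof.
move=> [injp _ _]; rewrite cardsU1 card_imset; last first.
  by move=> i j /injp ij; apply: val_inj; have := ij (ltn_ord i) (ltn_ord j) => -[].
case: imsetP => // -[i _] /injp; by move=> /(_ isT (ltn_ord i)).
Qed.

(** A vertex of [h] off the path would extend the path at [p 0]. *)
Lemma free_edge_on_path p e h x : bpath H l p e -> h \in free_edges p e -> x \in h ->
  exists2 k, k <= l & x = p k.
Proof.
move=> P /free_edgesP[hH p0 ne] xh.
have [/existsP[k /eqP kE]|/existsPn n] := boolP [exists k : 'I_l.+1, x == p k].
  by exists k => //; rewrite -ltnS.
case: (Hmax (bpath_cons P _ hH xh p0 ne)) => i il pix.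
by have := n (Ordinal (il : i < l.+1)); rewrite -pix eqxx.
Qed.

Lemma free_edge_sub p e h : bpath H l p e ->
  h \in free_edges p e -> h \subset free_ball p e.
Proof.
move=> P hF; apply/subsetP => x xh; have [[|k] kl xE] := free_edge_on_path P hF xh; subst x.
  by rewrite setU11.
rewrite !inE; apply/orP; right; apply/imsetP; exists (Ordinal kl) => //.
by rewrite inE; apply/existsP; exists h; rewrite hF.
Qed.

Lemma deg_end p e : bpath H l p e -> r < #|own_edges p e| + #|free_edges p e|.
Proof.
move=> P; apply: leq_trans (Hdeg (p 0)) _.
apply: leq_trans (_ : #|[set e (val i) | i : 'I_l in own_edges p e] :|: free_edges p e| <= _).
  apply/subset_leq_card/subsetP => h; rewrite !inE => /andP[hH p0h].
  rewrite hH p0h /=; case: forallP => [|/forallP/forallPn[j]]; first by rewrite orbT.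
  rewrite negbK => /eqP ej; rewrite orbF; apply/imsetP; exists j; rewrite ?inE ej //.
by apply: leq_trans (leq_card_setU _ _) _; rewrite leq_add2r leq_imset_card.
Qed.

(** Own edges inject into start links, so degree above r yields a free edge. It fits in [free_ball],
    whose size is |[free_nbrs]| + 1, so [free_nbrs] has r - 1 or r elements. With r it fills
    [slinks]; with r - 1 the ball is the only free edge, and the own edges must account for all r
    links. *)
Lemma few_slinks p e : bpath H l p e -> #|slinks p e| <= r ->
  #|slinks p e| = r /\
  (free_nbrs p e = slinks p e \/
   exists f, [/\ free_edges p e = [set f], own_edges p e = slinks p e,
                #|free_nbrs p e|.+1 = r & f = free_ball p e]).
Proof.
move=> P Xr; have deg := deg_end P.
have AX := own_sub_slinks P; have NX := free_sub_slinks p e.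
have AXc := subset_leq_card AX; have NXc := subset_leq_card NX.
have /card_gt0P[f fF] : 0 < #|free_edges p e| by lia.
have ballc : #|free_ball p e| = #|free_nbrs p e|.+1 := card_ball _ P.
have card_free h : h \in free_edges p e -> #|h| = r by case/free_edgesP=> /Hr.
have fB := free_edge_sub P fF; have := subset_leq_card fB; rewrite card_free // ballc => rN.
have [Nr|Nr] := leqP r #|free_nbrs p e|.
  by split; [lia | left; apply/eqP; rewrite eqEcard NX; lia].
have F1 : free_edges p e = [set free_ball p e].
  apply/eqP; rewrite eqEsubset sub1set; apply/andP; split.
    apply/subsetP => h hF; rewrite inE eqEcard free_edge_sub // ballc card_free //.
  suff <- : f = free_ball p e by [].
  by apply/eqP; rewrite eqEcard fB ballc card_free.
move: deg; rewrite F1 cards1 => deg.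
split; first by lia.
right; exists (free_ball p e); split=> //; last by lia.
by apply/eqP; rewrite eqEcard AX; lia.
Qed.

Lemma slinks_ge p e : bpath H l p e -> r <= #|slinks p e|.
Proof.
move=> P; rewrite leqNgt; apply/negP => lt.
by have [] := few_slinks P (ltnW lt); lia.
Qed.

Lemma elinks_ge p e : bpath H l p e -> r <= #|elinks p e|.
Proof. by move=> P; rewrite -card_slinks_rev; apply/slinks_ge/bpath_rev. Qed.

(* If all start links come from free edges, the end links are exactly the other
   indices, so the start links form an initial segment. Some path edge [e i] at
   [p 0] leaves this segment, say at [p m.+1]; trading it for a free edge
   reaching [p i.+1] makes it a start link crossing the end link at [m]. *)
Lemma free_nbrs_neq_slinks p e : bpath H l p e -> #|slinks p e| = r ->
  free_nbrs p e <> slinks p e.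
Proof.
move=> P Xr NX.
(* The complement has l - r <= r elements, while [elinks] has at least r. *)
have YX : elinks p e = ~: slinks p e.
  apply/eqP; rewrite eqEcard; apply/andP; split.
    apply/subsetP => i iY; rewrite inE -NX; apply/negP => /(free_nbrs_not_elinks P).
    by rewrite iY.
  have := elinks_ge P; have := cardsC (slinks p e); rewrite card_ord; lia.
have down (i : 'I_l) k : i \in slinks p e -> k <= i ->
    exists2 j : 'I_l, j = k :> nat & j \in slinks p e.
  move=> iX; elim: {k}(i - k) {-2}k (erefl (i - k)) => [|d IHd] k dE ki.
    by exists i => //=; lia.
  have [||j jk jX] := IHd k.+1; [by lia | by lia |].
  have kl : k < l by have := ltn_ord i; lia.
  exists (Ordinal kl) => //; apply/negP => /negP; rewrite -in_setC -YX => /elinksP[h2 E2].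
  have /slinksP[h1] := jX; rewrite jk => S1.
  by apply: slink_elink_pred P _ S1 E2; rewrite -jk.
pose B := free_ball p e.
have Bc : #|B| = r.+1 by rewrite (card_ball _ P) NX Xr.
(* Without [p 0], the ball has r elements and so only r subsets of size r - 1, too few for more than
   r edges at [p 0]. *)
have [h /andP[hH p0h] hB] : exists2 h, (h \in H) && (p 0 \in h) & ~~ (h \subset B).
  apply/exists_inP; rewrite -negb_forall_in; apply/negP => /forall_inP all.
  pose E0 := [set h in H | p 0 \in h].
  have D1inj : {in E0 &, injective (fun h => h :\ p 0)}.
    move=> h1 h2; rewrite !inE => /andP[_ p1] /andP[_ p2] E.
    by rewrite -(setD1K p1) E setD1K.
  have := card_ksubsets (L := [set h :\ p 0 | h in E0]) (B := B :\ p 0) (k := r.-1).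
  rewrite card_in_imset //; have := cardsD1 (p 0) B; rewrite Bc setU11 add1n => -[<-].
  have -> : 'C(r, r.-1) = r by case: (r) r_ge3 => // k _; rewrite binSn.
  have := Hdeg (p 0); rewrite /degree -/E0 ltnNge => /negP no le; apply: no; apply: le.
  move=> _ /imsetP[h hE ->]; move: (hE); rewrite inE => /andP[hH p0h].
  split; first by apply: setSD; apply: all; rewrite hH.
  by have := cardsD1 (p 0) h; rewrite p0h Hr //; lia.
have [/existsP[i /eqP ei]|/existsPn ne] := boolP [exists i : 'I_l, e i == h]; last first.
  case/negP: hB; apply: free_edge_sub => //; apply/free_edgesP; split=> // j jl.
  by have /eqP := ne (Ordinal jl).
subst h.
have iX : i \in slinks p e by apply: (subsetP (own_sub_slinks P)); rewrite inE.
have := iX; rewrite -NX inE => /existsP[f /andP[fF pif]].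
have Sf := free_slink fF pif.
have P' := bpath_rot_slink P (ltn_ord i) Sf.
have /free_edgesP[fH p0f nef] := fF.
have [_ inje pe] := P; have [_ pii _] := pe i (ltn_ord i).
have hF' : e i \in free_edges (rotp i 0 p) (rote i 0 f e).
  apply/free_edgesP; rewrite rotp0; split=> //; apply: rote_avoid => //.
    by move/esym; apply: nef.
  by move=> j jl ji /inje ij; apply: ji; apply: ij.
have /subsetPn[x xh xB] := hB.
have [k kl xk] := free_edge_on_path P' hF' xh.
have [m ml xm] : exists2 m, m <= l & x = p m.
  move: xk; rewrite /rotp addn0; case: leqP => _ ->; last by exists k.
  by exists (i - k) => //; apply: leq_trans (leq_subr _ _) (ltnW (ltn_ord i)).
case: m ml xm => [|m] ml xm; first by rewrite xm setU11 in xB.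
have mX : Ordinal ml \notin slinks p e.
  apply: contra xB; rewrite -NX xm => mN; rewrite !inE; apply/orP; right.
  by apply/imsetP; exists (Ordinal ml).
have im : i < m.
  rewrite ltnNge; apply/negP => mi; have [j jm jX] := down i m iX mi.
  by case/negP: mX; rewrite (_ : Ordinal ml = j) //; apply: val_inj.
have: Ordinal ml \in elinks p e by rewrite YX inE.
case/elinksP=> g G; have [gH plg pmg neg] := G.
suff E : e i = g by case: (neg i (ltn_ord i) _ E) => /= im'; rewrite im' ltnn in im.
apply: (@slink_elink _ _ m _ _ P' ml).
  by apply: free_slink => //; rewrite /rotp leqNgt ltnS ltnW //= addn0 -xm.
by apply: elink_rot => //; apply: free_not_elink P fF G.
Qed.

Lemma few_slinksP p e : bpath H l p e -> #|slinks p e| <= r ->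
  exists f, [/\ free_edges p e = [set f], own_edges p e = slinks p e,
               #|slinks p e| = r, #|free_nbrs p e|.+1 = r & f = free_ball p e].
Proof.
move=> P /(few_slinks P)[Xr [NX|[f [? ? ? ?]]]]; last by exists f.
by case: (free_nbrs_neq_slinks P Xr NX).
Qed.

(** * Rotating at an end with at most r links *)

Lemma free_nbrs1 p e f (i : 'I_l) : free_edges p e = [set f] ->
  (i \in free_nbrs p e) = (p i.+1 \in f).
Proof.
move=> F1; rewrite inE; apply/existsP/idP => [[h]|pf]; last by exists f; rewrite F1 inE eqxx.
by rewrite F1 inE => /andP[/eqP->].
Qed.

Lemma few_slinks_contra p e : bpath H l p e -> #|slinks p e| <= r ->
    (forall i f, i \in free_nbrs p e -> f \in [set e i] :|: free_edges p e ->
       #|slinks (rotp i 0 p) (rote i 0 f e)| <= r) ->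
  False.
Proof.
move=> P Xr rotr; have [f [F1 AX _ Nr fE]] := few_slinksP P Xr.
have fF : f \in free_edges p e by rewrite F1 inE.
have /free_edgesP[fH p0f nef] := fF.
have [injp inje pe] := P.
(* If the free edge [fi] after rotating through [e i] were not [f], then rotating through [f]
   instead would leave both [fi] and [e i] free at [p i]. Uniqueness gives [fi = e i], but [fi] is
   not a path edge. *)
have stay i : i < l -> p i.+1 \in f ->
    bpath H l (rotp i 0 p) (rote i 0 (e i) e) /\
    free_edges (rotp i 0 p) (rote i 0 (e i) e) = [set f].
  move=> il pif; have iN : Ordinal il \in free_nbrs p e by rewrite (free_nbrs1 _ F1).
  have p0ei : p 0 \in e i.
    have: Ordinal il \in own_edges p e by rewrite AX; apply: (subsetP (free_sub_slinks p e)).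
    by rewrite inE.
  have Pi := bpath_rot_slink P il (own_slink P il p0ei).
  have Pf := bpath_rot_slink P il (free_slink fF pif).
  split=> //.
  have [|fi [Fi _ _ _ _]] := few_slinksP Pi.
    by apply: (rotr (Ordinal il)); rewrite // !inE eqxx.
  have [|g [Fg _ _ _ _]] := few_slinksP Pf.
    by apply: (rotr (Ordinal il)); rewrite // inE fF orbT.
  rewrite Fi; congr [set _]; apply/eqP/negP => /negP fif.
  have [eiH pii _] := pe i il.
  have : e i \in free_edges (rotp i 0 p) (rote i 0 f e).
    apply/free_edgesP; rewrite rotp0; split=> //; apply: rote_avoid => //.
      by move/esym; apply: nef.
    by move=> j jl ji /inje ij; apply: ji; apply: ij.
  have : fi \in free_edges (rotp i 0 p) (rote i 0 (e i) e) by rewrite Fi inE.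
  case/free_edgesP=> fiH pifi nfi.
  have nfi' := rote_avoid_inv il nfi.
  have : fi \in free_edges (rotp i 0 p) (rote i 0 f e).
    apply/free_edgesP; rewrite rotp0 in pifi *; split=> //; apply: rote_avoid => //.
      by move/esym/eqP; apply/negP.
    by move=> j jl _; apply: nfi'.
  by rewrite Fg !inE => /eqP fig /eqP eig; apply: (nfi' i il); rewrite eig.
have down i : i < l -> p i.+1 \in f -> p i \in f.
  move=> il pif; have [_ Fi] := stay i il pif.
  have : f \in free_edges (rotp i 0 p) (rote i 0 (e i) e) by rewrite Fi inE.
  by case/free_edgesP=> _; rewrite rotp0.
have /card_gt0P[i0 i0N] : 0 < #|free_nbrs p e| by lia.
have exm : exists m, (0 < m <= l) && (p m \in f).
  by exists i0.+1; rewrite ltn_ord -(free_nbrs1 _ F1).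
have [m /andP[/andP[m_gt0 ml] pmf] m_max] :
    exists2 m, (0 < m <= l) && (p m \in f) & forall k, k <= l -> p k \in f -> k <= m.
  case: (ex_maxnP exm (m := l)) => [k|m mP mmax]; first by lia.
  by exists m => // -[|k] kl pk //; apply: mmax; rewrite kl pk.
have below k : k <= m -> p k \in f.
  elim: {k}(m - k) {-2}k (erefl (m - k)) => [|d IHd] k dE km.
    by have -> : k = m by lia.
  by apply: down; [lia | apply: IHd; lia].
have ml' : m.-1 < l by lia.
have [emH pm1 pm] := pe m.-1 ml'; rewrite prednK // in pm.
(* Both edges have r vertices, so it is enough that [f] lies inside [e m.-1]. *)
apply: (nef m.-1 ml'); apply/esym/eqP; rewrite eqEcard !Hr // leqnn andbT.
apply/subsetP => x xf; have [k kl xk] := free_edge_on_path P fF xf; subst x.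
have km := m_max k kl xf.
have [->//|km'] := eqVneq k m.
have [->//|km1] := eqVneq k m.-1.
have k_lt : k < m.-1 by clear -km km' km1; lia.
have k_ltm : k < m := leq_trans k_lt (leq_pred m).
have kl' : k < l := ltn_trans k_lt ml'.
(* After rotating at [k], the step from [p m.-1] to [p m] is still in place and [p m] is a free
   neighbour of the new start [p k]. Start links being own edges, [p k] lies in [e m.-1]. *)
have [Pk Fk] := stay k kl' (below _ k_ltm).
have [|g [_ AXk _ _ _]] := few_slinksP Pk.
  apply: (rotr (Ordinal kl')); last by rewrite !inE eqxx.
  by rewrite (free_nbrs1 _ F1); apply: below.
have : Ordinal ml' \in own_edges (rotp k 0 p) (rote k 0 (e k) e).
  rewrite AXk; apply: (subsetP (free_sub_slinks _ _)); rewrite (free_nbrs1 _ Fk) /=.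
  by rewrite prednK // /rotp leqNgt k_ltm addn0.
by rewrite inE rotp0 /= /rote addn0; case: ltngtP k_lt.
Qed.

(** Start links and shifted end links now fill ['I_l.+1], so the successor of each index in
    [free_nbrs] is again a start link. As just one start link [a] is not in [free_nbrs], all indices
    up to [a] are start links and [i < a]. Hence every end link exceeds [i] and survives the
    rotation at [i], leaving room for at most r start links. *)
Lemma many_elinks_contra p e : bpath H l p e ->
  #|slinks p e| <= r -> r < #|elinks p e| -> False.
Proof.
move=> P Xr Yr; apply: (few_slinks_contra P Xr) => i f' iN f'P.
have [f [F1 AX Xc Nr fE]] := few_slinksP P Xr.
have fF : f \in free_edges p e by rewrite F1 inE.
have NX := free_sub_slinks p e.
have full : [set widen_ord (leqnSn l) i | i in slinks p e] :|:
            [set lift ord0 i | i in elinks p e] = setT.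
  apply/eqP; rewrite eqEcard subsetT card_slinks_elinks // cardsT card_ord.
  by rewrite Xc; clear -Yr l_le; lia.
pose inX k := exists2 j : 'I_l, j = k :> nat & j \in slinks p e.
have next (x : 'I_l) : x \in free_nbrs p e -> inX x.+1.
  move=> xN; have := in_setT (lift ord0 x); rewrite -full inE => /orP[] /imsetP[y yS].
    by move=> /(congr1 val) /= yE; exists y.
  move/lift_inj => xy; subst y; by have := free_nbrs_not_elinks P xN; rewrite yS.
have X0 : inX 0.
  have := in_setT (ord0 : 'I_l.+1); rewrite -full inE.
  case/orP=> /imsetP[y yS] => /(congr1 val) //= yE.
  by exists y.
have /cards1P[a XN] : #|slinks p e :\: free_nbrs p e| == 1.
  by rewrite cardsD (setIidPr NX) Xc -Nr subSnn.
have aN : a \notin free_nbrs p e by have := set11 a; rewrite -XN => /setDP[].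
have uniqa x : x \in slinks p e -> x \notin free_nbrs p e -> x = a.
  by move=> xX xN; apply/set1P; rewrite -XN in_setD xN xX.
have ia : i < a.
  rewrite ltnNge; apply/negP => ai.
  have up d : inX (i + d).
    elim: d => [|d [j jE jX]]; first by exists i; rewrite ?addn0 //; apply: (subsetP NX).
    have jN : j \in free_nbrs p e.
      apply: contraT => /(uniqa j jX) ja.
      suff ai' : a = i by rewrite ai' iN in aN.
      by apply: val_inj; apply/eqP; rewrite /= eqn_leq ai -ja jE leq_addr.
    by have := next j jN; rewrite jE addnS.
  by have [j jE _] := up l; have := ltn_ord j; rewrite jE ltnNge leq_addl.
have low k : k <= a -> inX k.
  elim: k => // k IHk ka; have [j jE jX] := IHk (ltnW ka).
  rewrite -jE; apply: next; apply: contraT => jN.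
  by have ja := uniqa j jX jN; rewrite -jE ja ltnn in ka.
have iY y : y \in elinks p e -> i < y.
  move=> yY; rewrite ltnNge; apply/negP => yi.
  have [j jy jX] := low y (ltnW (leq_ltn_trans yi ia)).
  have {jy}jy : j = y by apply: val_inj.
  subst j; suff yN : y \in free_nbrs p e by have := free_nbrs_not_elinks P yN; rewrite yY.
  by apply: contraT => yN; have ya := uniqa y jX yN; move: yi; rewrite ya leqNgt ia.
have [injp inje pe] := P.
have Sf' : slink p e i f'.
  move: f'P; rewrite 2!inE => /orP[/eqP->|]; last first.
    by rewrite F1 inE => /eqP->; apply: free_slink; rewrite // -(free_nbrs1 _ F1).
  apply: own_slink => //; suff: i \in own_edges p e by rewrite inE.
  by rewrite AX; apply: (subsetP NX).
have Pi := bpath_rot_slink P (ltn_ord i) Sf'.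
have := leq_slinks_elinks Pi.
suff: #|elinks p e| <= #|elinks (rotp i 0 p) (rote i 0 f' e)| by lia.
apply/subset_leq_card/subsetP => y yY; have iy := iY y yY.
have /elinksP[g G] := yY; have [gH plg pyg neg] := G.
apply/elinksP; exists g; apply: elink_rot => //.
move: f'P; rewrite 2!inE => /orP[/eqP->|f'F]; last exact: free_not_elink P f'F G.
by apply: neg => // iy'; rewrite iy' ltnn in iy.
Qed.

(** If a path has more than r start links, its reverse contradicts [many_elinks_contra]. So every
    path of length [l], rotated ones included, has at most r, as [few_slinks_contra] requires. *)
Lemma no_bpath p e : ~ bpath H l p e.
Proof.
have few q g : bpath H l q g -> #|slinks q g| <= r.
  move=> Q; rewrite leqNgt; apply/negP => gt; have := leq_slinks_elinks Q => le.
  apply: (many_elinks_contra (bpath_rev Q)).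
    by rewrite card_slinks_rev; lia.
  by rewrite card_elinks_rev.
move=> P; apply: (few_slinks_contra P (few _ _ P)) => i f iN fP.
apply: (few _ _ _); apply: bpath_rot_slink => //.
have [f0 [F1 AX _ _ _]] := few_slinksP P (few _ _ P).
move: fP; rewrite 2!inE => /orP[/eqP->|fF].
  apply: own_slink => //; suff: i \in own_edges p e by rewrite inE.
  by rewrite AX; apply: (subsetP (free_sub_slinks _ _)).
apply: free_slink => //; move: (fF); rewrite F1 inE => /eqP->.
by rewrite -(free_nbrs1 _ F1).
Qed.

End PathEnds.

(** * The lower bound on the longest Berge path *)

Theorem theorem3p6 (r n : nat) (V : finType) (H : {set {set V}}) :
  3 <= r -> 2 * r * (r - 1) < n -> #|V| = n ->
  uniform r H -> connected H ->
  r < min_degree H -> 2 * r + 1 <= longest_berge_path H.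
Proof.
move=> r_ge3 n_gt cardV Hr Hconn Hdeg; rewrite addn1 ltnNge; apply/negP => l_le.
have V_gt0 : 0 < #|V| by lia.
have /has_berge_pathP[p [e]] := longest_berge_path_attained H V_gt0.
have nolong q g : ~ bpath H (longest_berge_path H).+1 q g.
  move=> Q; have : has_berge_path H (longest_berge_path H).+1.
    by apply/has_berge_pathP; exists q, g.
  by move/leq_longest_berge_path; rewrite ltnn.
have V_gt : 2 * r * (r - 1) < #|V| by rewrite cardV.
have {}Hdeg := min_degree_gtP _ _ V_gt0 Hdeg.
apply: (no_bpath r_ge3 l_le Hr Hdeg nolong) => q g h.
  exact: (no_chord r_ge3 l_le V_gt Hconn nolong).
exact: (no_small_chord r_ge3 l_le V_gt Hr Hconn Hdeg nolong).
Qed.
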